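(* Let $\{\rho_k\}_{k=0}^{M-1}$ be a finite collection of density operators (test states) on a system $A'$, and let $\{|\Gamma_k\rangle\}_{k=0}^{M-1}$ and $\{|\Delta_k\rangle\}_{k=0}^{M-1}$ be two sets of purifications of the test states on $A'A''$, i.e. unit vectors with $\mathrm{Tr}_{A''}|\Gamma_k\rangle\langle\Gamma_k|=\mathrm{Tr}_{A''}|\Delta_k\rangle\langle\Delta_k|=\rho_k$ for all $k$. Assume that there is a completely positive, trace-preserving (CPTP) map $\Omega$ such that $$\Omega\big[|\Gamma_k\rangle\langle\Gamma_k|\big]=|\Delta_k\rangle\langle\Delta_k|\quad\text{for all }k.$$ Consider a device whose output state on a system $B$, when probed with the test state $\rho_k$, is $\rho_k^{\mathrm{out}}$, and let $\{\hat O_B^j\}_j$ be the set of observables measured on the output states (tomographically complete or not). If benchmarking of the device with the purifications $\{|\Delta_k\rangle\}$ is unsuccessful, then benchmarking of the same device (same output states, same measured observables) with the purifications $\{|\Gamma_k\rangle\}$ is unsuccessful. Here ''unsuccessful'' (one cannot conclude that the device is in the quantum domain) is meant in the sense defined in the context: there exists a measure-and-prepare channel that maps the chosen purifications to states compatible with the measured data. Explicitly: if there exists a measure-and-prepare channel $\tilde\Lambda_{MP}$ from $A'A''$ to $B$ with $\tilde\Lambda_{MP}[|\Delta_k\rangle\langle\Delta_k|]\in\mathcal C[\rho_k^{\mathrm{out}}]$ for all $k$, then there exists a measure-and-prepare channel $\Sigma_{MP}$ from $A'A''$ to $B$ with $\Sigma_{MP}[|\Gamma_k\rangle\langle\Gamma_k|]\in\mathcal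 C[\rho_k^{\mathrm{out}}]$ for all $k$.
   Context: Systems $A',A'',B$ are described by (separable) Hilbert spaces; $\Omega$ acts from operators on $A'A''$ to operators on $A'A''$. A measure-and-prepare (MP) channel from $A'A''$ to $B$ is a CPTP map obtained by measuring the input state with some POVM and preparing an output density operator on $B$ depending only on the classical measurement outcome, i.e. $\sigma\mapsto\int \mathrm{Tr}(\sigma\,dE(x))\,\tau_x$ (a sum $\sum_x\mathrm{Tr}(\sigma E_x)\tau_x$ for discrete outcomes), with $E$ a POVM on $A'A''$ and $\tau_x$ density operators on $B$. The output states $\rho_k^{\mathrm{out}}$ of the device depend only on the physical test states $\rho_k$ and not on which purifications are used in the theoretical description: the device is described as a CPTP map $\Lambda$ from $A'A''$ to $B$ satisfying $\Lambda[|\Delta_k\rangle\langle\Delta_k|]=\Lambda[|\Gamma_k\rangle\langle\Gamma_k|]=\rho_k^{\mathrm{out}}$ for all $k$. For measured observables $\{\hat O_B^j\}_j$, the set of states compatible with the data for the $k$-th test state is $$\mathcal C[\rho_k^{\mathrm{out}}]=\{\tau \text{ density operator on } B:\ \mathrm{Tr}(\tau\hat O_B^j)=\mathrm{Tr}(\rho_k^{\mathrm{out}}\hat O_B^j)\ \ \forall j\}.$$ If the measurements are tomographically complete, $\mathcal C[\rho_k^{\mathrm{out}}]=\{\rho_k^{\mathrm{out}}\}$. Benchmarking of the device using a set of purifications $\{|\Phi_k\rangle\}$ of the test states is called unsuccessful if there is an MP channel $\Lambda_{MP}$ from $A'A''$ to $B$ with $\Lambda_{MP}[|\Phi_k\rangle\langle\Phi_k|]\in\mathcal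 C[\rho_k^{\mathrm{out}}]$ for all $k$; in this case one cannot conclude, from the data and the purifications $\{|\Phi_k\rangle\}$, that the device is in the quantum domain. *)

(* Defs.v *)
(* MathComp-Analysis *)
From HB Require Import structures.
From mathcomp Require Import all_boot all_order all_algebra.
From mathcomp Require Import all_classical all_reals all_analysis.
From mathcomp Require Import complex.

Set Implicit Arguments.
Unset Strict Implicit.
Unset Printing Implicit Defensive.

Import Order.TTheory GRing.Theory Num.Theory.
Import numFieldNormedType.Exports.

Local Open Scope classical_set_scope.
Local Open Scope ring_scope.

(* MathComp-Analysis equips R[i]^o, but not R[i], with the norm topology. *)
HB.instance Definition _ (R : realType) := NormedModule.copy R[i] R[i]^o.

HB.mixin Record CompleteNormedModule_isSepHilbert (R : realType) H
    of CompleteNormedModule R[i] H := {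
  inner : {dot H for @Num.conj R[i]} ;
  normr_inner : forall x : H, `|x| ^+ 2 = inner x x ;
  separable : exists u : nat -> H, dense (range u)
}.

#[short(type="sepHilbertType")]
HB.structure Definition SepHilbert (R : realType) :=
  {H of CompleteNormedModule R[i] H & CompleteNormedModule_isSepHilbert R H}.

(* Linear in the first argument, as all MathComp forms: the physicists'
   <v|T|u> is '[T u, v]. *)
Notation "''[' u , v ]" := (inner u v) : ring_scope.

Lemma innerC (R : realType) (H : sepHilbertType R) (x y : H) :
  '[x, y] = ('[y, x])^*.
Proof. by rewrite hermC /= expr0 mul1r. Qed.

Section gram_schmidt.
Context {R : realType}.
Variables (H : sepHilbertType R) (u : nat -> H).

Definition gs_residue (s : seq H) (x : H) := x - \sum_(v <- s) '[x, v] *: v.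

Fixpoint gs_seq n : seq H :=
  if n is m.+1 then
    let r := gs_residue (gs_seq m) (u m) in rcons (gs_seq m) (`|r|^-1 *: r)
  else [::].

Definition gram_schmidt n := last 0 (gs_seq n.+1).

Local Notation e := gram_schmidt.

Lemma gs_seqE n : gs_seq n = [seq e i | i <- iota 0 n].
Proof.
elim: n => // n IH.
by rewrite -addn1 iotaD map_cat -IH /= addn1 cats1 /e /= last_rcons.
Qed.

Lemma gram_schmidtE n (r := u n - \sum_(i < n) '[u n, e i] *: e i) :
  e n = `|r|^-1 *: r.
Proof.
rewrite /r {1}/e /= last_rcons /gs_residue gs_seqE big_map.
by rewrite -[n in iota 0 n]subn0 -/(index_iota 0 n) big_mkord.
Qed.

Lemma gram_schmidt_norm n : e n = 0 \/ '[e n, e n] = 1.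
Proof.
rewrite gram_schmidtE; set r := (X in `|X|^-1 *: X).
have [->|r0] := eqVneq r 0; [by left; rewrite scaler0|right].
by rewrite -normr_inner normrZ normfV normr_id mulVf ?expr1n// normr_eq0.
Qed.

Lemma gram_schmidt_ortho i j : i != j -> '[e i, e j] = 0.
Proof.
suff lo n : forall k, (k < n)%N -> '[e n, e k] = 0.
  case: ltngtP => // ij _; last exact: lo.
  by rewrite innerC lo// rmorph0.
elim/ltn_ind: n => n IH k kn.
rewrite gram_schmidtE linearZl_LR /= linearBl linear_sumlz /=.
suff -> : \sum_(i < n) '['[u n, e i] *: e i, e k] = '[u n, e k].
  by rewrite subrr mulr0.
rewrite (bigD1 (Ordinal kn)) //= big1 ?addr0 => [|l lk].
  rewrite linearZl_LR /=; case: (gram_schmidt_norm k) => ->.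
    by rewrite !linear0r ?mulr0 ?mul0r.
  by rewrite mulr1.
rewrite linearZl_LR /=; suff -> : '[e l, e k] = 0 by rewrite mulr0.
have : (l : nat) != k by [].
case: ltngtP => // lk' _; last exact: IH.
by rewrite innerC IH// rmorph0.
Qed.

Lemma gram_schmidt_total x : dense (range u) ->
  (forall n, '[x, e n] = 0) -> x = 0.
Proof.
move=> du xe; apply/eqP/negPn/negP => x0.
have xu n : '[x, u n] = 0.
  set r := u n - \sum_(i < n) '[u n, e i] *: e i.
  have -> : u n = `|r| *: e n + \sum_(i < n) '[u n, e i] *: e i.
    rewrite gram_schmidtE -/r scalerA.
    have [r0|r0] := eqVneq r 0.
      by rewrite r0 scaler0 add0r; apply/eqP; rewrite -subr_eq0 -/r r0.
    by rewrite divff ?normr_eq0// scale1r subrK.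
  rewrite linearDr linearZr_LR /= xe mulr0 add0r linear_sumr big1 // => i _.
  by rewrite linearZr_LR /= xe mulr0.
have [||z [xB [n _ unz]]] := du (ball x `|x|).
- by exists x; apply: ballxx; rewrite normr_gt0.
- by apply: ball_open; rewrite normr_gt0.
have {xB} : `|x - z| < `|x| by rewrite -ball_normE in xB.
rewrite -(@ltr_pXn2r _ 2) ?nnegrE// !normr_inner -unz hnormBd//.
by rewrite gtrDl => /lt_geF; rewrite dnorm_ge0.
exact: xu.
Qed.

End gram_schmidt.

Section operators.
Context {R : realType}.
Implicit Types H K : sepHilbertType R.

(* Operators are plain functions, with pointwise vector space structure. *)
Definition bounded_op H (T : H -> H) := linear T /\ continuous T.

Definition positive_op H (T : H -> H) :=
  bounded_op T /\ forall x, 0 <= '[T x, x].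

Definition ketbra H (u : H) : H -> H := fun x => '[x, u] *: u.

(* Zero vectors are allowed as padding, so that finite-dimensional spaces are
   covered by the same nat-indexed definition; they do not contribute to any
   of the sums below. *)
Definition is_onb H (e : nat -> H) :=
  [/\ forall i j, i != j -> '[e i, e j] = 0,
      forall i, e i = 0 \/ '[e i, e i] = 1
    & forall x, (forall i, '[x, e i] = 0) -> x = 0].

Definition onb H : nat -> H := get (@is_onb H).

Lemma onbP H : is_onb (@onb H).
Proof.
apply: getPex; have [u du] := @separable R H.
exists (gram_schmidt u); split.
- exact: gram_schmidt_ortho.
- exact: gram_schmidt_norm.
- by move=> x; exact: gram_schmidt_total du.
Qed.

Definition diag_series H (T : H -> H) : R[i]^nat :=
  series (fun n => '[T (onb H n), onb H n]).

Definition trace H (T : H -> H) : R[i] := limn (diag_series T).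

Definition positive_trace_class H (T : H -> H) :=
  positive_op T /\ cvgn (diag_series T).

(* The trace-class operators are the complex linear span of the positive
   operators with finite trace (as in Pedersen, Analysis Now, 3.4.6). *)
Definition trace_class H (T : H -> H) :=
  exists (n : nat) (a : 'I_n -> R[i]) (P : 'I_n -> (H -> H)),
    (forall k, positive_trace_class (P k)) /\ T = \sum_k a k *: P k.

Definition density_op H (T : H -> H) :=
  positive_trace_class T /\ trace T = 1.

(* Positivity of an n x n matrix of operators, seen as an operator on the
   direct sum of n copies of H. *)
Definition block_positive H n (S : 'I_n -> 'I_n -> (H -> H)) :=
  forall x : 'I_n -> H, 0 <= \sum_i \sum_j '[S i j (x j), x i].

(* Only the values of Omega on trace-class operators are meaningful; complete
   positivity is positivity of the maps that Omega induces entrywise on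
   n x n matrices of trace-class operators, for every n. *)
Definition cptp H K (Omega : (H -> H) -> (K -> K)) :=
  [/\ forall T, trace_class T -> trace_class (Omega T),
      forall a S T, trace_class S -> trace_class T ->
        Omega (a *: S + T) = a *: Omega S + Omega T,
      forall n (S : 'I_n -> 'I_n -> (H -> H)),
        (forall i j, trace_class (S i j)) ->
        block_positive S -> block_positive (fun i j => Omega (S i j))
    & forall T, trace_class T -> trace (Omega T) = trace T].

(* t realises K as the Hilbert space tensor product of H1 and H2. *)
Definition hilbert_tensor H1 H2 K (t : H1 -> H2 -> K) :=
  [/\ forall b, linear (t^~ b), forall a, linear (t a),
      forall a b c d, '[t a b, t c d] = '[a, c] * '[b, d]
    & dense [set x | exists n (a : 'I_n -> H1) (b : 'I_n -> H2),
                       x = \sum_i t (a i) (b i)]].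

(* rho is the partial trace over H2 of the operator T on the tensor product. *)
Definition is_partial_trace H1 H2 K (t : H1 -> H2 -> K)
    (T : K -> K) (rho : H1 -> H1) :=
  bounded_op rho /\ forall a b,
    series (fun n => '[T (t b (onb H2 n)), t a (onb H2 n)]) @ \oo
      --> '[rho b, a].

Definition purification H1 H2 K (t : H1 -> H2 -> K)
    (rho : H1 -> H1) (u : K) :=
  `|u| = 1 /\ is_partial_trace t (ketbra u) rho.

Definition povm d (X : measurableType d) H (E : set X -> (H -> H)) :=
  [/\ forall A, measurable A -> positive_op (E A),
      E setT = id
    & forall F : (set X)^nat, (forall i, measurable (F i)) ->
        trivIset setT F -> forall x,
        series (fun i => '[E (F i) x, x]) @ \oo
          --> '[E (\bigcup_i F i) x, x]].

(* mu is the outcome distribution A |-> Tr (sigma E(A)) when sigma is measured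
   with E; such a mu exists, and is unique on measurable sets, for every
   density operator sigma. *)
Definition is_outcome_law d (X : measurableType d) H (E : set X -> (H -> H))
    (sigma : H -> H) (mu : {measure set X -> \bar R}) :=
  forall A, measurable A -> mu A = (complex.Re (trace (sigma \o E A)))%:E.

(* The operator-valued integral of tau against the outcome distribution is
   expressed weakly, through its (nonnegative) quadratic form, on input
   states; linearity determines Lambda on all trace-class operators. *)
Definition mp_channel H K (Lambda : (H -> H) -> (K -> K)) :=
  cptp Lambda /\
  exists (d : measure_display) (X : measurableType d)
         (E : set X -> (H -> H)) (tau : X -> (K -> K)),
    [/\ povm E,
        forall x, density_op (tau x),
        forall v, measurable_fun setT (fun x => complex.Re '[tau x v, v])
      & forall sigma, density_op sigma ->
          exists2 mu : {measure set X -> \bar R}, is_outcome_law E sigma mu &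
          forall v, (complex.Re '[Lambda sigma v, v])%:E =
                    (\int[mu]_x (complex.Re '[tau x v, v])%:E)%E].

(* Self-adjoint, possibly unbounded, operators; values of the function off the
   domain are meaningless.  The last field says that the graph of the operator
   is the graph of its adjoint. *)
Record observable H := Observable {
  obs_dom : set H ;
  obs_fun :> H -> H ;
  obs_dense : dense obs_dom ;
  obs_linear : forall a x y, obs_dom x -> obs_dom y ->
    obs_dom (a *: x + y) /\ obs_fun (a *: x + y) = a *: obs_fun x + obs_fun y ;
  obs_selfadjoint : forall y z,
    obs_dom y /\ obs_fun y = z <->
    forall x, obs_dom x -> '[obs_fun x, y] = '[x, z] }.

(* Tr (tau O) is defined, with value r, when the densely defined operator
   tau O extends to a trace-class operator (automatic if O is bounded). *)
Definition has_expectation H (tau : H -> H) (O : observable H) (r : R[i]) :=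
  exists T, [/\ trace_class T, forall x, obs_dom O x -> T x = tau (O x)
              & trace T = r].

Definition compatible H (J : Type) (O : J -> observable H) (rho : H -> H) :
    set (H -> H) :=
  [set tau | density_op tau /\
    forall j, exists2 r, has_expectation rho (O j) r
                       & has_expectation tau (O j) r].

Definition unsuccessful H K (M : nat) (J : Type) (O : J -> observable K)
    (rho_out : 'I_M -> (K -> K)) (Phi : 'I_M -> H) :=
  exists Lambda : (H -> H) -> (K -> K),
    mp_channel Lambda /\
    forall k, compatible O (rho_out k) (Lambda (ketbra (Phi k))).

End operators.

(* Main.v *)
(** In the Heisenberg picture the dual of a CPTP map sends POVMs to POVMs, so
    precomposing a measure-and-prepare channel with a CPTP map yields a
    measure-and-prepare channel; precomposing with the map [Omega] that sends
    [Gamma k] to [Delta k] gives the claim.  The dual of an effect [E] is the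
    operator that represents the functional [T |-> Tr (Omega T \o E)].  On
    rank-one operators this is the Riesz representation.  It extends to all positive
    trace-class operators because such an operator, after subtraction of
    finitely many rank-one operators, is positive with arbitrarily small trace:
    iterated Schur complements along the orthonormal basis play the role of
    the spectral theorem. *)
From HB Require Import structures.
Require Import Defs.
From mathcomp Require Import all_boot all_order all_algebra.
From mathcomp Require Import all_classical all_reals all_analysis.
From mathcomp Require Import complex ring.

Set Implicit Arguments.
Unset Strict Implicit.
Unset Printing Implicit Defensive.

Import Order.TTheory GRing.Theory Num.Theory.
Import numFieldNormedType.Exports.

Local Open Scope classical_set_scope.
Local Open Scope ring_scope.


(** * Order, limits and series in the complex numbers *)

Section complex_limits.
Context {R : realType}.
Implicit Types (u v : R[i]^nat) (r : R^nat).

Lemma normr_real_complex (x : R) : `|x%:C%C| = `|x|%:C%C.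
Proof. by rewrite normc_def /= expr0n addr0 sqrtr_sqr. Qed.

Lemma cvg_real_complex r (x : R) : r @ \oo --> x ->
  (r n)%:C%C @[n --> \oo] --> (x%:C%C : R[i]).
Proof.
move=> /cvgrPdist_lt rx; apply/cvgrPdist_lt => e e0.
have er : (complex.Re e)%:C%C = e by rewrite RRe_real// gtr0_real.
have /rx : 0 < complex.Re e by rewrite -ltcR er.
by apply: filterS => n; rewrite -rmorphB normr_real_complex -ltcR er.
Qed.

(** The terms equal their own moduli, so by continuity of the norm the limit equals its own
    modulus. *)
Lemma cvg_ge0 u (l : R[i]) : u @ \oo --> l -> (forall n, 0 <= u n) -> 0 <= l.
Proof.
move=> ul u0; suff -> : l = `|l| by [].
have nl : u @ \oo --> `|l|.
  rewrite [X in X @ _ --> _](_ : u = fun n => `|u n|); first exact: cvg_norm.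
  by apply/funext => n; rewrite ger0_norm.
by rewrite -[LHS](cvg_lim (@norm_hausdorff _ _) ul); exact: cvg_lim nl.
Qed.

Lemma cvg_le u v (l m : R[i]) : u @ \oo --> l -> v @ \oo --> m ->
  (forall n, u n <= v n) -> l <= m.
Proof.
move=> ul vm uv; rewrite -subr_ge0; apply: (@cvg_ge0 (v - u)).
  by apply: cvgB; [exact vm|exact ul].
by move=> n; rewrite subr_ge0.
Qed.

(** Nonnegative complex numbers are real, so the partial sums come from a bounded nondecreasing real
    sequence. *)
Lemma is_cvg_ge0_series u (K : R[i]) : (forall n, 0 <= u n) ->
  (forall n, series u n <= K) -> cvgn (series u).
Proof.
move=> u0 uK.
have K0 : 0 <= K by apply: le_trans (uK 0%N); rewrite /series/= big_geq.
have uE n : u n = (complex.Re (u n))%:C%C by rewrite RRe_real// ger0_real.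
have KE : K = (complex.Re K)%:C%C by rewrite RRe_real// ger0_real.
have sE n : series u n = (series (@complex.Re R \o u) n)%:C%C.
  by rewrite /series/= rmorph_sum; apply: eq_bigr => i _ /=.
have : cvgn (series (@complex.Re R \o u)).
  apply: nondecreasing_is_cvgn.
    by apply: nondecreasing_series => n _ _ /=; rewrite -ler0c -uE.
  by exists (complex.Re K) => _ [n _ <-]; rewrite -lecR -sE -KE.
move=> /cvg_real_complex/cvgP; rewrite (_ : (fun n => _) = series u)//.
exact/funext.
Qed.

Lemma le_series_limn u (K : R[i]) : (forall n, 0 <= u n) ->
  (forall n, series u n <= K) -> limn (series u) <= K.
Proof.
move=> u0 uK; apply: cvg_le (is_cvg_ge0_series u0 uK) (@cvg_cst _ K _ _ _) uK.
Qed.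

Lemma series_le_limn u n : (forall n, 0 <= u n) -> cvgn (series u) ->
  series u n <= limn (series u).
Proof.
move=> u0 uc; rewrite -subr_ge0.
apply: (@cvg_ge0 (fun m => series u (m + n)%N - series u n)).
  by apply: cvgB; [rewrite cvg_shiftn|exact: cvg_cst].
move=> m; rewrite subr_ge0 /series/= (big_cat_nat (leq0n n) (leq_addl m n))/=.
by rewrite lerDl sumr_ge0.
Qed.

(** Real and imaginary parts are dominated by the modulus, so each gives an absolutely convergent
    real series. *)
Lemma is_cvg_abs_series u (K : R[i]) :
  (forall n, \sum_(0 <= i < n) `|u i| <= K) -> cvgn (series u).
Proof.
move=> uK.
have dom (a : R^nat) : (forall n, `|a n|%:C%C <= `|u n|) ->
    cvgn (fun n => (series a n)%:C%C : R[i]).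
  move=> au; suff : cvgn (series a) by move=> /cvg_real_complex/cvgP.
  apply: normed_cvg; apply: nondecreasing_is_cvgn.
    by apply: nondecreasing_series => n _ _; exact: normr_ge0.
  exists (complex.Re K) => _ [n _ <-]; rewrite -lecR.
  have K0 : 0 <= K by apply: le_trans (uK 0%N); rewrite big_geq.
  rewrite RRe_real ?ger0_real//; apply: le_trans (uK n).
  by rewrite /series/= rmorph_sum; apply: ler_sum => i _; exact: au.
have -> : series u = fun n => (series (@complex.Re R \o u) n)%:C%C +
    'i%C * (series (@complex.Im R \o u) n)%:C%C.
  apply/funext => n; rewrite /series/= !rmorph_sum mulr_sumr -big_split/=.
  by apply: eq_bigr => i _; exact: complexE.
apply: is_cvgD; first by apply: dom => n; exact: normc_ge_Re.
apply: is_cvgMr; apply: dom => n /=.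
(* The imaginary part of a number is the real part of its product with [- 'i], which has the same
   modulus. *)
have := normc_ge_Re (- 'i%C * u n).
by rewrite normrM normrN normc_def/= expr0n expr1n add0r sqrtr1 mul1r
   mulNr -mulrC raddfN/= ReiNIm opprK.
Qed.

Lemma norm_limn_le u (K : R[i]) : cvgn u -> (forall n, `|u n| <= K) ->
  `|limn u| <= K.
Proof.
by move=> uc; apply: cvg_le (cvg_norm uc) (@cvg_cst _ K _ _ _).
Qed.

End complex_limits.

(** * Positive semidefinite sesquilinear forms *)

Section psd_forms.
Context {C : numClosedFieldType} {U : lmodType C}.
Implicit Types (B : U -> U -> C).

Definition psd_form B :=
  [/\ forall y, scalar (B^~ y),
      forall x a y z, B x (a *: y + z) = a^* * B x y + B x z
    & forall x, 0 <= B x x].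

Lemma psd_form_expand B a x y : psd_form B ->
  B (a *: y + x) (a *: y + x) =
    a * a^* * B y y + a * B y x + a^* * B x y + B x x.
Proof.
move=> [Bl Br _]; rewrite Br !Bl.
by ring.
Qed.

(** Diagonal values are real, so expanding at [a *: y + x] shows that [a * B y x + a^* * B x y] is
    real for every [a]; the cases [1] and ['i] suffice. *)
Lemma psd_form_herm B x y : psd_form B -> B y x = (B x y)^*.
Proof.
move=> Bpsd; have [Bl Br B0] := Bpsd.
have realB z : (B z z)^* = B z z by rewrite conj_Creal// ger0_real.
have expand a : (a * B y x + a^* * B x y)^* = a * B y x + a^* * B x y.
  have := realB (a *: y + x); rewrite (psd_form_expand _ _ _ Bpsd).
  rewrite -[_ + _ + a^* * _]addrA !rmorphD/= !realB.
  have -> : (a * a^* * B y y)^* = a * a^* * B y y.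
    by rewrite !rmorphM/= conjCK realB [a^* * a]mulrC.
  by move/addIr/addrI.
have := expand 1; have := expand 'i.
rewrite conjCi conjC1 !mul1r !mulNr !rmorphD rmorphN !rmorphM/= conjCi !mulNr.
rewrite opprK => h1 h2.
(* Multiplying the condition at [1] by ['i] and adding the condition at ['i] isolates
   [2 * 'i * B y x]. *)
apply: (@mulfI _ (2 * 'i)); first by rewrite mulf_neq0 ?pnatr_eq0 ?neq0Ci.
move: (B y x) (B x y) (B y x)^* (B x y)^* h1 h2 => p q p' q'.
transitivity ('i * (p + q) + ('i * p - 'i * q)); first by ring.
by rewrite -h1 -h2; ring.
Qed.

(** Positivity at [(- s * B x y) *: y + x] is a quadratic inequality in the real parameter [s]; its
    best choice is the inverse of [B y y]. *)
Lemma psd_form_cauchy_schwarz B x y : psd_form B ->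
  `|B x y| ^+ 2 <= B x x * B y y.
Proof.
move=> Bpsd; have [Bl Br B0] := Bpsd.
have quad (s : C) : s \is Num.real ->
    0 <= B x x - 2 * s * `|B x y| ^+ 2 + s ^+ 2 * `|B x y| ^+ 2 * B y y.
  move=> sr; have := B0 ((- s * B x y) *: y + x).
  rewrite (psd_form_expand _ _ _ Bpsd) (psd_form_herm x y Bpsd).
  rewrite rmorphM rmorphN/= (CrealP sr) normCK.
  by congr (_ <= _); ring.
have [Byy|Byy] := eqVneq (B y y) 0.
  rewrite Byy mulr0 real_leNgt ?ger0_real//; apply/negP => Bxy0.
  (* With [B y y = 0] the bound is affine in [s], and this value turns it into the negative number
     [- (B x x + 2)]. *)
  have := quad ((B x x + 1) / `|B x y| ^+ 2).
  rewrite Byy mulr0 addr0 mulrA divfK ?gt_eqF//.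
  set b := B x x; have -> : b - 2 * (b + 1) = - (b + 2) by ring.
  have b0 : 0 <= b by exact: B0.
  rewrite oppr_ge0 ger0_real ?divr_ge0 ?addr_ge0 ?exprn_ge0// => /(_ isT).
  by rewrite lt_geF// ltr_wpDl.
have := quad (B y y)^-1.
rewrite realV ger0_real// => /(_ isT).
set n := `|_| ^+ 2; set a := B x x; set b := B y y.
have -> : a - 2 / b * n + b^-1 ^+ 2 * n * b = a - n / b.
  by field.
rewrite subr_ge0 ler_pdivrMr// lt_def Byy; exact: B0.
Qed.
End psd_forms.

(** * Orthonormal expansions in a separable Hilbert space *)

Section hilbert.
Context {R : realType}.
Implicit Types H K : sepHilbertType R.
Local Notation C := R[i].

Lemma psd_inner H : psd_form (@inner R H).
Proof.
split=> [y a u v|x a y z|x].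
- by rewrite linearDl linearZl_LR.
- by rewrite linearDr linearZr_LR.
- exact: dnorm_ge0.
Qed.

Lemma inner0r H (x : H) : '[x, 0] = 0 :> C.
Proof. exact: linear0r. Qed.

Lemma inner0l H (x : H) : '[0, x] = 0 :> C.
Proof. exact: linear0l. Qed.

Lemma norm_inner_le H (x y : H) : `|'[x, y]| <= `|x| * `|y|.
Proof.
rewrite -ler_sqr ?nnegrE ?mulr_ge0// exprMn !normr_inner.
exact: psd_form_cauchy_schwarz (psd_inner H).
Qed.

Lemma inner_eq H (x y : H) : (forall z, '[x, z] = '[y, z]) -> x = y.
Proof.
move=> xy; apply/eqP; rewrite -subr_eq0; rewrite -(@dnorm_eq0 _ _ (@inner R H)).
by rewrite linearBl/= xy subrr.
Qed.

Lemma cvg_dominated (V W : normedModType C) (u : V^nat) (l : V) (f : W^nat)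
    (b : W) (K : C) : 0 <= K ->
  (forall n, `|b - f n| <= K * `|l - u n|) -> u @ \oo --> l -> f @ \oo --> b.
Proof.
move=> K0 fu /cvgrPdist_lt ul; apply/cvgrPdist_lt => e e0.
(* Dividing by [K + 1] instead of [K] covers [K = 0]. *)
have K1 : 0 < K + 1 by rewrite ltr_wpDl.
have /ul : 0 < e / (K + 1) by rewrite divr_gt0.
apply: filterS => n; rewrite ltr_pdivlMr// mulrC => ule.
apply: le_lt_trans ule; apply: le_trans (fu n) _.
by rewrite ler_wpM2r// lerDl.
Qed.

Lemma cvg_innerl H (u : H^nat) l (y : H) : u @ \oo --> l ->
  '[u n, y] @[n --> \oo] --> '[l, y].
Proof.
apply: (@cvg_dominated _ _ _ _ _ _ `|y|) => // n.
by rewrite -linearBl/= mulrC norm_inner_le.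
Qed.

Lemma onb_ortho H i j : i != j -> '[onb H i, onb H j] = 0.
Proof. by have [h _ _] := onbP H; exact: h. Qed.

Lemma onb01 H i : onb H i = 0 \/ '[onb H i, onb H i] = 1.
Proof. by have [_ h _] := onbP H; exact: h. Qed.

Lemma onb_total H (x : H) : (forall i, '[x, onb H i] = 0) -> x = 0.
Proof. by have [_ _ h] := onbP H; exact: h. Qed.

(** The factor ['[onb H k, onb H k]] cannot be replaced by [1]: it is [0] when the basis vector is
    padding. *)
Lemma inner_onb_sum H (c : C^nat) m n k :
  '[\sum_(m <= i < n) c i *: onb H i, onb H k] =
    if (m <= k < n)%N then c k * '[onb H k, onb H k] else 0.
Proof.
rewrite linear_sumlz/=; case: ifPn => [mkn|].
  rewrite (bigD1_seq k) ?iota_uniq ?mem_index_iota//= linearZl_LR/=.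
  rewrite big1_seq ?addr0// => i /andP[ik _].
  by rewrite linearZl_LR/= onb_ortho// mulr0.
move=> mkn; rewrite big_nat_cond big1// => i; rewrite andbT => mi.
rewrite linearZl_LR/= onb_ortho ?mulr0//.
by apply: contraNneq mkn => <-.
Qed.

Lemma norm_onb_sum H (c : C^nat) m n :
  `|\sum_(m <= i < n) c i *: onb H i| ^+ 2 =
    \sum_(m <= i < n) `|c i| ^+ 2 * '[onb H i, onb H i].
Proof.
rewrite normr_inner linear_sumr; apply: eq_big_nat => k mkn.
rewrite linearZr_LR/= inner_onb_sum mkn mulrA normCK; congr (_ * _).
by rewrite mulrC.
Qed.

Lemma norm_onb_sum_le H (c : C^nat) m n :
  `|\sum_(m <= i < n) c i *: onb H i| ^+ 2 <= \sum_(m <= i < n) `|c i| ^+ 2.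
Proof.
rewrite norm_onb_sum; apply: ler_sum => i _.
by case: (onb01 H i) => ->; rewrite ?mulr1// inner0l mulr0 exprn_ge0.
Qed.

(** Pythagoras: the partial expansion [p] of [x] is orthogonal to [x - p]. *)
Lemma bessel H (x : H) n : \sum_(0 <= i < n) `|'[x, onb H i]| ^+ 2 <= `|x| ^+ 2.
Proof.
set p := \sum_(0 <= i < n) '[x, onb H i] *: onb H i.
have -> : \sum_(0 <= i < n) `|'[x, onb H i]| ^+ 2 = `|p| ^+ 2.
  rewrite norm_onb_sum; apply: eq_bigr => i _.
  case: (onb01 H i) => [->|->]; last by rewrite mulr1.
  by rewrite inner0r normr0 expr0n mul0r.
have xp : '[x - p, p] = 0.
  rewrite {2}/p linear_sumr big_nat_cond big1// => i /andP[i_n _].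
  rewrite linearZr_LR/= linearBl/= /p inner_onb_sum i_n.
  case: (onb01 H i) => ->; first by rewrite !inner0r mulr0 subrr mulr0.
  by rewrite mulr1 subrr mulr0.
rewrite !normr_inner -[x in leRHS](subrK p) hnormDd// lerDr.
exact: dnorm_ge0.
Qed.

(** The squared norm of a block of the series is at most the corresponding block of a convergent
    real series; completeness of [H] does the rest. *)
Lemma is_cvg_onb_series H (c : C^nat) (K : C) :
  (forall n, \sum_(0 <= i < n) `|c i| ^+ 2 <= K) ->
  cvgn (series (fun i => c i *: onb H i)).
Proof.
move=> cK; apply/cauchy_cvgP/cauchy_seriesP => e e0.
have : cvgn (series (fun i => `|c i| ^+ 2)).
  by apply: is_cvg_ge0_series cK => n; exact: exprn_ge0.
move=> /cvg_cauchy/cauchy_seriesP/(_ (e ^+ 2)); rewrite exprn_gt0// => /(_ isT).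
apply: filterS => -[m n]/= le; rewrite -(@ltr_pXn2r _ 2) ?nnegrE//; last exact: ltW.
apply: le_lt_trans (norm_onb_sum_le _ _ _ _) _.
by rewrite ger0_norm ?sumr_ge0// in le => i _; exact: exprn_ge0.
Qed.

(** Bessel's inequality gives convergence; the limit has the same coordinates as [x], so totality of
    the basis identifies the two. *)
Lemma onb_expansion H (x : H) :
  series (fun i => '[x, onb H i] *: onb H i) @ \oo --> x.
Proof.
set s := series _.
have sc : cvgn s by exact: is_cvg_onb_series (bessel x).
suff <- : limn s = x by [].
apply/eqP; rewrite -subr_eq0; apply/eqP; apply: onb_total => k.
rewrite linearBl/=; apply/eqP; rewrite subr_eq0; apply/eqP.
have := cvg_innerl (y := onb H k) sc.
move=> /(cvg_lim (@norm_hausdorff _ _)) <-.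
apply: cvg_lim; first exact: norm_hausdorff.
apply: cvg_near_cst; exists k.+1 => // n /= kn.
apply/eqP; rewrite /s /series/= inner_onb_sum/= kn.
by case: (onb01 H k) => ->; rewrite ?mulr1// !inner0r mulr0.
Qed.

Lemma parseval H (x y : H) :
  series (fun i => '[x, onb H i] * '[onb H i, y]) @ \oo --> '[x, y].
Proof.
rewrite (_ : series _ = fun n =>
  '[series (fun i => '[x, onb H i] *: onb H i) n, y]).
  exact: cvg_innerl (@onb_expansion H x).
apply/funext => n; rewrite /series/= linear_sumlz/=; apply: eq_bigr => i _.
by rewrite linearZl_LR.
Qed.

End hilbert.

(** * Bounded, positive and trace-class operators *)

Section operator_theory.
Context {R : realType}.
Implicit Types H K : sepHilbertType R.
Local Notation C := R[i].

(** Operators are bare functions; bundling them gives access to the theory of linear maps. *)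
Lemma linear_linear H (T : H -> H) : linear T ->
  exists f : {linear H -> H}, f = T :> (H -> H).
Proof.
move=> lT; pose m := GRing.isLinear.Build _ _ _ _ T lT.
by exists (HB.pack_for {linear H -> H} T m).
Qed.

Lemma bounded_op_norm_le H (T : H -> H) : bounded_op T ->
  exists2 k : C, 0 <= k & forall x, `|T x| <= k * `|x|.
Proof.
move=> [/linear_linear[f <-] /(_ 0)/continuous_linear_bounded].
move=> /(_ 0)/linear_boundedP/pinfty_ex_gt0[k k0 fk].
by exists k => //; exact: ltW.
Qed.

Lemma norm_le_bounded_op H (T : H -> H) (k : C) : 0 <= k -> linear T ->
  (forall x, `|T x| <= k * `|x|) -> bounded_op T.
Proof.
move=> k0 lT Tk; split=> //; have [f fT] := linear_linear lT.
rewrite -fT; apply: bounded_linear_continuous; apply/linear_boundedP.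
exists k; split; first exact: ger0_real.
by move=> r kr x; rewrite fT (le_trans (Tk x))// ler_wpM2r// ltW.
Qed.

Lemma bounded_op_lin H a (S T : H -> H) : bounded_op S -> bounded_op T ->
  bounded_op (a *: S + T).
Proof.
move=> bS bT; have [k k0 Sk] := bounded_op_norm_le bS.
have [l l0 Tl] := bounded_op_norm_le bT.
have [[lS _] [lT _]] := (bS, bT).
apply: (@norm_le_bounded_op _ _ (`|a| * k + l)).
  by rewrite addr_ge0 ?mulr_ge0.
  move=> c x y; rewrite !fctE lS lT !scalerDr !scalerA [a * c]mulrC.
  by rewrite addrACA.
move=> x; rewrite !fctE mulrDl -mulrA.
by apply: le_trans (ler_normD _ _) _; rewrite normrZ lerD// ler_wpM2l.
Qed.

Lemma zero_opE H (x : H) : (0 : H -> H) x = 0.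
Proof. by []. Qed.

Lemma bounded_op0 H : bounded_op (0 : H -> H).
Proof.
apply: (@norm_le_bounded_op _ _ 0) => // [a x y|x].
  by rewrite !zero_opE scaler0 addr0.
by rewrite zero_opE normr0 mul0r.
Qed.

Lemma positive_psd H (T : H -> H) : positive_op T ->
  psd_form (fun x y => '[T x, y]).
Proof.
move=> [[lT _] T0]; split=> // [y a u v|x a y z].
- by rewrite lT linearDl/= linearZl_LR.
- by rewrite linearDr/= linearZr_LR.
Qed.

(** Over the complex numbers positivity forces self-adjointness, through the hermitian symmetry of
    the form of [T]. *)
Lemma positive_adj H (T : H -> H) x y : positive_op T -> '[T x, y] = '[x, T y].
Proof.
by move=> /positive_psd/psd_form_herm ->; rewrite [RHS]innerC.
Qed.

(** The operator |x><y|, with [ketbra u] as the case [dyad u u]. Composed with it, a linear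
    functional on trace-class operators becomes a sesquilinear form. *)
Definition dyad H (x y : H) : H -> H := fun z => '[z, y] *: x.

Lemma linear_dyad H (x y : H) : linear (dyad x y).
Proof.
move=> a u v; rewrite /dyad linearDl/= linearZl_LR/=.
by rewrite scalerDl scalerA.
Qed.

Lemma positive_ketbra H (u : H) : positive_op (ketbra u).
Proof.
split; last first.
  by move=> x; rewrite /ketbra linearZl_LR/= [X in _ * X]innerC -normCK exprn_ge0.
apply: (@norm_le_bounded_op _ _ (`|u| * `|u|)).
- by rewrite mulr_ge0.
- exact: linear_dyad.
- by move=> x; rewrite /ketbra normrZ mulrAC ler_wpM2r// mulrC norm_inner_le.
Qed.

Lemma cvg_diag_ketbra H (u : H) : diag_series (ketbra u) @ \oo --> `|u| ^+ 2.
Proof.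
rewrite normr_inner; rewrite (_ : diag_series _ =
  series (fun i => '[u, onb H i] * '[onb H i, u])); first exact: parseval.
apply/funext => n; rewrite /diag_series /series/=; apply: eq_bigr => i _.
by rewrite /ketbra linearZl_LR/= mulrC.
Qed.

Lemma cvg_trace H (T : H -> H) (l : C) :
  diag_series T @ \oo --> l -> trace T = l.
Proof. by move=> Tl; apply: cvg_lim Tl; exact: norm_hausdorff. Qed.

Lemma ptc_ketbra H (u : H) : positive_trace_class (ketbra u).
Proof.
by split; [exact: positive_ketbra|exact: cvgP (@cvg_diag_ketbra _ u)].
Qed.

Lemma trace_ketbra H (u : H) : trace (ketbra u) = `|u| ^+ 2.
Proof. by apply: cvg_trace; exact: cvg_diag_ketbra. Qed.

Lemma cvg_diag_lin H a (S T : H -> H) (s t : C) :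
  diag_series S @ \oo --> s -> diag_series T @ \oo --> t ->
  diag_series (a *: S + T) @ \oo --> a * s + t.
Proof.
move=> Ss Tt.
have -> : diag_series (a *: S + T) =
    (fun n => a * diag_series S n + diag_series T n).
  apply/funext => n; rewrite /diag_series /series/= mulr_sumr -big_split/=.
  by apply: eq_bigr => i _; rewrite !fctE linearDl/= linearZl_LR.
by apply: cvgD; [apply: cvgMr|exact: Tt]; exact: Ss.
Qed.

Lemma is_cvg_diag_lin H a (S T : H -> H) : cvgn (diag_series S) ->
  cvgn (diag_series T) -> cvgn (diag_series (a *: S + T)) /\
  trace (a *: S + T) = a * trace S + trace T.
Proof.
move=> cS cT; have h := cvg_diag_lin (a := a) cS cT.
by split; [exact: cvgP h|exact: cvg_trace h].
Qed.

Lemma diag_series0 H : diag_series (0 : H -> H) = fun=> 0.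
Proof.
apply/funext => n; rewrite /diag_series /series/= big1// => i _.
by rewrite zero_opE inner0l.
Qed.

Lemma trace_class0 H : trace_class (0 : H -> H).
Proof.
exists 0%N, (fun=> 0), (fun=> 0); split; first by case.
by rewrite big_ord0.
Qed.

Lemma trace_class_lin H a (S T : H -> H) : trace_class S -> trace_class T ->
  trace_class (a *: S + T).
Proof.
move=> [m [c [P [Pptc ->]]]] [n [d [Q [Qptc ->]]]].
exists (m + n)%N,
  (fun k : 'I_(m + n) => match fintype.split k with inl i => a * c i | inr j => d j end),
  (fun k : 'I_(m + n) => match fintype.split k with inl i => P i | inr j => Q j end).
split=> [k|]; first by case: fintype.split.
rewrite big_split_ord/= scaler_sumr; congr (_ + _); apply: eq_bigr => i _.
  by rewrite (unsplitK (inl i)) scalerA.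
by rewrite (unsplitK (inr i)).
Qed.

Lemma ptc_trace_class H (T : H -> H) : positive_trace_class T -> trace_class T.
Proof.
move=> Tptc; exists 1%N, (fun=> 1), (fun=> T); split=> //.
by rewrite big_ord1 scale1r.
Qed.

(** Induction on the number of terms in the span reduces linear properties to positive operators of
    finite trace. *)
Lemma trace_class_ind H (Q : (H -> H) -> Prop) :
  Q 0 ->
  (forall a P S, positive_trace_class P -> trace_class S -> Q S ->
    Q (a *: P + S)) ->
  forall T, trace_class T -> Q T.
Proof.
move=> Q0 QD T [n [a [P [Pptc ->]]]] {T}.
suff : trace_class (\sum_k a k *: P k) /\ Q (\sum_k a k *: P k) by case.
elim: n a P Pptc => [|n IH] a P Pptc.
  by rewrite big_ord0; split=> //; exact: trace_class0.
have [tS QS] := IH (a \o lift ord0) (P \o lift ord0) (fun k => Pptc _).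
rewrite big_ord_recl; split; last exact: QD.
by apply: trace_class_lin => //; exact: ptc_trace_class.
Qed.

Lemma trace_class_bounded H (T : H -> H) : trace_class T -> bounded_op T.
Proof.
move: T; apply: trace_class_ind; first exact: bounded_op0.
by move=> a P S [[bP _] _] _ bS; exact: bounded_op_lin.
Qed.

Lemma trace_class_is_cvg H (T : H -> H) : trace_class T -> cvgn (diag_series T).
Proof.
move: T; apply: trace_class_ind; first by rewrite diag_series0; exact: is_cvg_cst.
by move=> a P S [_ cP] _ cS; exact: (is_cvg_diag_lin a cP cS).1.
Qed.

Lemma trace_lin H a (S T : H -> H) : trace_class S -> trace_class T ->
  trace (a *: S + T) = a * trace S + trace T.
Proof.
move=> /trace_class_is_cvg cS /trace_class_is_cvg cT.
exact: (is_cvg_diag_lin a cS cT).2.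
Qed.

Lemma positive_trace_class_psd H (T : H -> H) : trace_class T ->
  (forall x, 0 <= '[T x, x]) -> positive_trace_class T.
Proof.
move=> tT T0; split; last exact: trace_class_is_cvg.
by split=> //; exact: trace_class_bounded.
Qed.

Lemma diag_series_le_trace H (T : H -> H) n : positive_trace_class T ->
  diag_series T n <= trace T.
Proof. by move=> [[_ T0] cT]; apply: series_le_limn. Qed.

Lemma trace_ge0 H (T : H -> H) : positive_trace_class T -> 0 <= trace T.
Proof.
move=> Tptc; apply: le_trans (diag_series_le_trace 0 Tptc).
by rewrite /diag_series /series/= big_geq.
Qed.

(* Polarization. *)
Lemma trace_class_dyad H (x y : H) : trace_class (dyad x y).
Proof.
have tk c (u : H) T : trace_class T -> trace_class (c *: ketbra u + T).
  by apply: trace_class_lin; exact/ptc_trace_class/ptc_ketbra.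
suff -> : dyad x y = 4^-1 *: ketbra (x + y) + ((- 4^-1) *: ketbra (x - y) +
    (('i / 4) *: ketbra (x + 'i *: y) + ((- 'i / 4) *: ketbra (x - 'i *: y) + 0))).
  by do 4!apply: (tk); exact: trace_class0.
apply/funext => z; rewrite !fctE /ketbra /dyad; apply: inner_eq => w.
rewrite zero_opE addr0 ?(linearDl, linearDr, linearNl, linearNr, linearZl_LR, linearZr_LR)/=.
rewrite ?(linearDl, linearDr, linearNl, linearNr, linearZl_LR, linearZr_LR)/=.
rewrite conjCi.
set p := '[z, x]; set q := '[z, y]; set a := '[x, w]; set b := '[y, w].
(* Keeping ['i * 'i] symbolic lets [ring] match the four expanded rank-one operators; its value [-1]
   then leaves only [q * a]. *)
transitivity (4^-1 * (2 * p * b + 2 * q * a + 2 * ('i * 'i) * (p * b - q * a))).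
  by rewrite -expr2 sqrCi; field.
by rewrite /GRing.scale/=; ring.
Qed.

End operator_theory.

(** * Approximation of positive trace-class operators by finite sums of rank-one operators *)

Section finite_rank_approximation.
Context {R : realType}.
Implicit Types H K : sepHilbertType R.
Local Notation C := R[i].

(** For [v] equal to [T e] over the square root of ['[T e, e]], positivity of the difference is the
    Cauchy-Schwarz inequality for the form of [T]. The last clause makes the construction
    iterable. *)
Lemma schur_complement H (T : H -> H) e : positive_op T ->
  exists v, [/\ positive_op (T - ketbra v), (T - ketbra v) e = 0
    & forall z, T z = 0 -> (T - ketbra v) z = 0].
Proof.
move=> Tpos; have [bT T0] := Tpos.
(* When [c = 0], the convention that [0] has inverse [0] makes [v] zero; Cauchy-Schwarz then gives
   [T e = 0]. *)
pose c := '[T e, e]; pose v := (sqrtC c)^-1 *: T e.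
have c0 : 0 <= c by exact: T0.
have vE z : ketbra v z = (c^-1 * '[T z, e]) *: T e.
  rewrite /ketbra /v linearZr_LR/= -(positive_adj z e Tpos) scalerA.
  rewrite mulrAC fmorphV/= conj_Creal ?ger0_real ?sqrtC_ge0//.
  by rewrite -invfM -expr2 sqrtCK.
have vform z : '[ketbra v z, z] = c^-1 * `|'[T z, e]| ^+ 2.
  rewrite vE linearZl_LR/= normCK -mulrA; congr (_ * (_ * _)).
  by rewrite innerC -(positive_adj z e Tpos).
exists v; split.
- split.
    rewrite addrC -scaleN1r; apply: bounded_op_lin => //.
    by have [] := positive_ketbra v.
  move=> z; rewrite !fctE linearBl/= subr_ge0 vform.
  have := psd_form_cauchy_schwarz z e (positive_psd Tpos); rewrite -/c => cs.
  have [->|cn0] := eqVneq c 0; first by rewrite invr0 mul0r T0.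
  by rewrite mulrC ler_pdivrMr// lt_def cn0.
- rewrite !fctE vE -/c; have [c00|cn0] := eqVneq c 0; last first.
    by rewrite mulVf// scale1r subrr.
  rewrite c00 mulr0 scale0r subr0; apply: inner_eq => w; rewrite inner0l.
  apply/eqP; rewrite -normr_eq0 -sqrf_eq0 eq_le exprn_ge0// andbT.
  have := psd_form_cauchy_schwarz e w (positive_psd Tpos).
  by rewrite -/c c00 mul0r.
- by move=> z Tz; rewrite !fctE vE Tz inner0l mulr0 scale0r subr0.
Qed.

(** One complement is taken per basis vector, and vectors annihilated earlier stay annihilated. *)
Lemma iterated_schur_complement H (T : H -> H) N : positive_op T ->
  exists s : seq H, let S := T - \sum_(v <- s) ketbra v in
    positive_op S /\ forall i, (i < N)%N -> S (onb H i) = 0.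
Proof.
move=> Tpos; elim: N => [|N [s [Spos S0]]].
  by exists [::]; rewrite /= big_nil subr0.
have [v [vpos ve vz]] := schur_complement (onb H N) Spos.
exists (v :: s); rewrite /= big_cons [ketbra v + _]addrC opprD addrA.
split=> // i; rewrite ltnS leq_eqVlt => /predU1P[->//|/S0]; exact: vz.
Qed.

Lemma inner_sum_ketbra H (s : seq H) x y :
  '[(\sum_(v <- s) ketbra v) x, y] = \sum_(v <- s) '[x, v] * '[v, y].
Proof.
rewrite fct_sumE linear_sumlz/=; apply: eq_bigr => v _.
by rewrite /ketbra linearZl_LR.
Qed.

Lemma trace_class_sum_ketbra H (s : seq H) :
  trace_class (\sum_(v <- s) ketbra v).
Proof.
elim: s => [|v s IH]; first by rewrite big_nil; exact: trace_class0.
rewrite big_cons -[ketbra v]scale1r; apply: trace_class_lin => //.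
exact/ptc_trace_class/ptc_ketbra.
Qed.

Lemma trace_sum_ketbra H (s : seq H) :
  trace (\sum_(v <- s) ketbra v) = \sum_(v <- s) `|v| ^+ 2.
Proof.
elim: s => [|v s IH].
  rewrite !big_nil; apply: cvg_trace; rewrite diag_series0; exact: cvg_cst.
rewrite !big_cons -{1}[ketbra v]scale1r trace_lin ?mul1r ?trace_ketbra ?IH//.
  exact/ptc_trace_class/ptc_ketbra.
exact: trace_class_sum_ketbra.
Qed.

(** The remainder [S] lies below [T] and vanishes on the first [N] basis vectors, so its trace is at
    most a tail of the diagonal series of [T]. The squared norms sum to the trace of [T - S]. *)
Lemma finite_rank_remainder H (T : H -> H) N : positive_trace_class T ->
  exists s : seq H, let S := T - \sum_(v <- s) ketbra v in
  [/\ positive_trace_class S, forall i, (i < N)%N -> S (onb H i) = 0,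
      forall x, '[S x, x] <= '[T x, x],
      \sum_(v <- s) `|v| ^+ 2 <= trace T
    & trace S <= trace T - diag_series T N].
Proof.
move=> Tptc; have [Tpos Tc] := Tptc.
have [s [Spos S0]] := iterated_schur_complement N Tpos; exists s => S.
rewrite -/S in Spos S0.
have ST x : '[S x, x] <= '[T x, x].
  rewrite /S !fctE linearBl/= lerBlDr lerDl inner_sum_ketbra sumr_ge0// => v _.
  by rewrite [X in _ * X]innerC -normCK exprn_ge0.
(* Up to [N] the partial sum of [S] is zero; beyond [N] its terms are bounded by those of [T]. *)
have Sle n : diag_series S n <= trace T - diag_series T N.
  rewrite lerBrDr; have [nN|Nn] := leqP n N.
    rewrite [diag_series S n]big_nat_cond big1 ?add0r.
      exact: diag_series_le_trace.
    by move=> i /andP[/andP[_ i_n] _]; rewrite S0 ?inner0l// (leq_trans i_n).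
  apply: le_trans (diag_series_le_trace n Tptc).
  rewrite /diag_series /series/= addrC.
  rewrite [in leRHS](big_cat_nat (leq0n N) (ltnW Nn))/= lerD2l.
  rewrite (big_cat_nat (leq0n N) (ltnW Nn))/= big_nat_cond big1 ?add0r.
    by apply: ler_sum => i _; exact: ST.
  by move=> i /andP[/andP[_ iN] _]; rewrite S0 ?inner0l.
have Sptc : positive_trace_class S.
  exact: (conj Spos (is_cvg_ge0_series (fun n => Spos.2 _) Sle)).
split=> //; last first.
  exact: (le_series_limn (fun n => Spos.2 _) Sle).
have -> : \sum_(v <- s) `|v| ^+ 2 = trace T - trace S.
  rewrite -trace_sum_ketbra (_ : \sum_(v <- s) _ = (-1) *: S + T); last first.
    by rewrite /S scaleN1r opprB subrK.
  by rewrite trace_lin ?mulN1r 1?addrC//; exact: ptc_trace_class.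
by rewrite gerBl; exact: trace_ge0.
Qed.

Lemma trace_remainder_small H (T : H -> H) (e : C) : positive_trace_class T ->
  0 < e -> exists s : seq H, let S := T - \sum_(v <- s) ketbra v in
  [/\ positive_trace_class S, \sum_(v <- s) `|v| ^+ 2 <= trace T
    & trace S <= e].
Proof.
move=> Tptc e0; have [_ /cvgrPdist_lt/(_ e e0)[N _ /(_ N (leqnn N))/= TN]] := Tptc.
have [s [Sptc _ _ sT Se]] := finite_rank_remainder N Tptc; exists s; split=> //.
by rewrite ger0_norm ?subr_ge0 ?diag_series_le_trace// in TN; exact: le_trans Se (ltW TN).
Qed.

Lemma cvg_harmonic_complex : (n.+1%:R^-1 : C) @[n --> \oo] --> (0 : C).
Proof.
have := cvg_real_complex (@cvg_harmonic R).
rewrite (_ : (fun n => _) = fun n => n.+1%:R^-1) //.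
by apply/funext => n; rewrite /harmonic fmorphV/= rmorph_nat.
Qed.

(** The order is only partial, so the proof passes to the limit along inverse integers instead of
    arguing by contradiction. *)
Lemma le_add_gt0 (x y : C) : (forall e, 0 < e -> x <= y + e) -> x <= y.
Proof.
move=> xy; have ye n : x <= y + n.+1%:R^-1 by apply: xy; rewrite invr_gt0.
have lim : (fun n => y + (n.+1%:R^-1 : C)) @ \oo --> y + 0.
  by apply: cvgD; [exact: cvg_cst|exact: cvg_harmonic_complex].
rewrite addr0 in lim.
exact: cvg_le (@cvg_cst _ _ _ _ _) lim ye.
Qed.

(** The rank-one parts satisfy the bound by Cauchy-Schwarz, as their squared norms sum to at most
    [trace T]. The remainder sees only the tail [d n] of the expansion of [x], which tends to
    zero. *)
Lemma form_le_trace H (T : H -> H) x : positive_trace_class T ->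
  '[T x, x] <= trace T * `|x| ^+ 2.
Proof.
move=> Tptc; have [[bT _] _] := Tptc; have [k k0 Tk] := bounded_op_norm_le bT.
pose d n := x - series (fun i => '[x, onb H i] *: onb H i) n.
have d0 : `|d n| @[n --> \oo] --> (0 : C).
  have : d @ \oo --> x - x by apply: cvgB; [exact: cvg_cst|exact: onb_expansion].
  by rewrite subrr => /cvg_norm; rewrite normr0.
have le_d n : '[T x, x] <= trace T * `|x| ^+ 2 + k * (`|d n| * `|d n|).
  have [s [Sptc S0 ST sT _]] := finite_rank_remainder n Tptc.
  set S := T - _ in Sptc S0 ST; have [Spos _] := Sptc.
  have [f fS] := linear_linear Spos.1.1.
  have -> : '[T x, x] = '[(\sum_(v <- s) ketbra v) x, x] + '[S x, x].
    by rewrite -linearDl/= -[S x]/(T x - _) addrC subrK.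
  apply: lerD.
    rewrite inner_sum_ketbra; apply: (@le_trans _ _ (\sum_(v <- s) `|v| ^+ 2 * `|x| ^+ 2)).
      apply: ler_sum => v _; rewrite [X in _ * X]innerC -normCK -exprMn mulrC.
      by rewrite ler_pXn2r ?nnegrE ?mulr_ge0// norm_inner_le.
    by rewrite -mulr_suml ler_wpM2r// exprn_ge0.
  have Sd : S (d n) = S x.
    rewrite /d -fS linearB/= /series/= linear_sum/= big_nat_cond big1 ?subr0//.
    by move=> i /andP[/andP[_ i_n] _]; rewrite linearZ/= fS S0// scaler0.
  (* Self-adjointness of [S] allows replacing [x] by its tail in both arguments. *)
  rewrite -Sd positive_adj// -Sd -positive_adj//.
  apply: le_trans (ST _) _; have [[_ T0] _] := Tptc.
  rewrite -[leLHS]ger0_norm//; apply: le_trans (norm_inner_le _ _) _.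
  by rewrite mulrA ler_wpM2r.
have lim : (fun n => trace T * `|x| ^+ 2 + k * (`|d n| * `|d n|)) @ \oo
    --> trace T * `|x| ^+ 2 + k * (0 * 0).
  apply: cvgD; first exact: cvg_cst.
  by apply: cvgMr; apply: cvgM; exact: d0.
rewrite !mulr0 addr0 in lim.
exact: cvg_le (@cvg_cst _ _ _ _ _) lim le_d.
Qed.

Lemma sum_norm_ketbra H (E : H -> H) v n : positive_op E ->
  \sum_(0 <= i < n) `|'[E (onb H i), v]| ^+ 2 <= `|E v| ^+ 2.
Proof.
move=> Epos; apply: le_trans (bessel (E v) n); apply: ler_sum => i _.
by rewrite (positive_adj _ _ Epos) innerC norm_conjC.
Qed.

(** This bounds the diagonal of [E \o T \o E]. Each rank-one part of [T] contributes at most the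
    squared norm of [E v], by Bessel; the remainder is controlled by its small trace. *)
Lemma sum_form_le_trace H (T E : H -> H) (k : C) n : 0 <= k ->
  positive_op E -> (forall x, `|E x| <= k * `|x|) -> positive_trace_class T ->
  \sum_(0 <= i < n) '[T (E (onb H i)), E (onb H i)] <= k ^+ 2 * trace T.
Proof.
move=> k0 Epos Ek Tptc; apply: le_add_gt0 => e e0.
(* [M] is fixed before the remainder is chosen, so the trace of the remainder can be made small
   relative to it. *)
pose M := \sum_(0 <= i < n) `|E (onb H i)| ^+ 2.
have M0 : 0 <= M by apply: sumr_ge0 => i _; exact: exprn_ge0.
have e' : 0 < e / (M + 1) by rewrite divr_gt0// ltr_wpDl.
have [s [Sptc sT Se]] := trace_remainder_small Tptc e'.
set S := T - _ in Sptc Se.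
have TE x : '[T x, x] = '[(\sum_(v <- s) ketbra v) x, x] + '[S x, x].
  by rewrite -linearDl/= -[S x]/(T x - _) addrC subrK.
under eq_bigr do rewrite TE; rewrite big_split/=; apply: lerD.
  under eq_bigr do rewrite inner_sum_ketbra.
  rewrite exchange_big/=; apply: le_trans (ler_wpM2l (exprn_ge0 2 k0) sT).
  rewrite mulr_sumr; apply: ler_sum => v _; rewrite -exprMn.
  apply: (@le_trans _ _ (`|E v| ^+ 2)); last first.
    by rewrite ler_pXn2r ?nnegrE ?mulr_ge0//.
  apply: le_trans (sum_norm_ketbra v n Epos); apply: ler_sum => i _.
  by rewrite [X in _ * X]innerC -normCK.
apply: (@le_trans _ _ (e / (M + 1) * M)).
  rewrite mulr_sumr; apply: ler_sum => i _.
  by apply: le_trans (form_le_trace _ Sptc) _; rewrite ler_wpM2r ?exprn_ge0.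
by rewrite mulrAC ler_pdivrMr ?ltr_wpDl// ler_pM2l// lerDl.
Qed.

(* AM-GM applied to the Cauchy-Schwarz inequality for the form of [T]. *)
Lemma norm_form_le H (T : H -> H) x y : positive_op T ->
  `|'[T x, y]| <= '[T x, x] + '[T y, y].
Proof.
move=> Tpos; have [_ T0] := Tpos.
rewrite -ler_sqr ?nnegrE ?addr_ge0//.
apply: le_trans (psd_form_cauchy_schwarz x y (positive_psd Tpos)) _.
rewrite sqrrD; set a := '[T x, x]; set b := '[T y, y].
rewrite -subr_ge0 (_ : _ - _ = a ^+ 2 + a * b + b ^+ 2); last by ring.
by rewrite !addr_ge0 ?mulr_ge0 ?exprn_ge0 ?T0.
Qed.

(** Each term is split into a diagonal entry of [E \o T \o E] and one of [T], both summable. *)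
Lemma sum_norm_diag_comp H (T E : H -> H) (k : C) n : 0 <= k ->
  positive_op E -> (forall x, `|E x| <= k * `|x|) -> positive_trace_class T ->
  \sum_(0 <= i < n) `|'[T (E (onb H i)), onb H i]| <= (k ^+ 2 + 1) * trace T.
Proof.
move=> k0 Epos Ek Tptc; have [Tpos _] := Tptc; rewrite mulrDl mul1r.
apply: (le_trans (ler_sum _ (fun i _ => norm_form_le _ _ Tpos))).
rewrite big_split/= lerD//; first exact: sum_form_le_trace.
exact: diag_series_le_trace.
Qed.
End finite_rank_approximation.

(** * Bounded functionals on trace-class operators and their representation *)

Section trace_functionals.
Context {R : realType}.
Implicit Types H K : sepHilbertType R.
Local Notation C := R[i].

(** The bound is stated on positive operators, whose trace norm is simply the trace. *)
Definition trace_functional H (f : (H -> H) -> C) :=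
  (forall a S T, trace_class S -> trace_class T ->
    f (a *: S + T) = a * f S + f T) /\
  exists2 k : C, 0 <= k &
    forall P, positive_trace_class P -> `|f P| <= k * trace P.

(** The product [T \o E] need not be positive, even for positive [T], so convergence comes from
    absolute summability. *)
Lemma trace_class_comp_is_cvg H (T E : H -> H) : positive_op E ->
  trace_class T -> cvgn (diag_series (T \o E)).
Proof.
move=> Epos; have [bE _] := Epos; have [k k0 Ek] := bounded_op_norm_le bE.
move: T; apply: trace_class_ind.
  by rewrite (_ : 0 \o E = 0)// diag_series0; exact: is_cvg_cst.
move=> a P S Pptc _ cS.
have -> : (a *: P + S) \o E = a *: (P \o E) + (S \o E) by [].
apply: (fun cP => (is_cvg_diag_lin a cP cS).1); apply: is_cvg_abs_series => n.
exact: (sum_norm_diag_comp n k0 Epos Ek Pptc).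
Qed.

Lemma trace_functional_comp H (E : H -> H) : positive_op E ->
  trace_functional (fun T => trace (T \o E)).
Proof.
move=> Epos; have [bE _] := Epos; have [k k0 Ek] := bounded_op_norm_le bE.
split.
  move=> a S T tS tT.
  have -> : (a *: S + T) \o E = a *: (S \o E) + (T \o E) by [].
  by apply: (is_cvg_diag_lin a _ _).2; exact: trace_class_comp_is_cvg.
exists (k ^+ 2 + 1); first by rewrite addr_ge0 ?exprn_ge0.
move=> P Pptc; apply: norm_limn_le.
  exact: trace_class_comp_is_cvg (ptc_trace_class Pptc).
move=> n; apply: le_trans (sum_norm_diag_comp n k0 Epos Ek Pptc).
exact: ler_norm_sum.
Qed.

Lemma trace_ketbra_comp H (E : H -> H) v : positive_op E ->
  trace (ketbra v \o E) = '[E v, v].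
Proof.
move=> Epos; apply: cvg_trace.
rewrite (_ : diag_series _ =
  series (fun i => '[v, onb H i] * '[onb H i, E v])).
  by rewrite (positive_adj v v Epos); exact: parseval.
apply/funext => n; rewrite /diag_series /series/=; apply: eq_bigr => i _.
by rewrite /ketbra linearZl_LR/= mulrC (positive_adj _ _ Epos).
Qed.

Lemma trace_functional_sub H (f g : (H -> H) -> C) :
  trace_functional f -> trace_functional g -> trace_functional (f - g).
Proof.
move=> [fl [k k0 fk]] [gl [l l0 gl']]; split.
  by move=> a S T tS tT; rewrite !fctE fl// gl//; ring.
exists (k + l); first exact: addr_ge0.
move=> P Pptc; rewrite !fctE mulrDl.
by apply: le_trans (ler_normB _ _) _; rewrite lerD ?fk ?gl'.
Qed.

Lemma trace_functional_additive H (f : (H -> H) -> C) : trace_functional f ->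
  f 0 = 0 /\ forall S T, trace_class S -> trace_class T ->
    f (S + T) = f S + f T.
Proof.
move=> [fl _]; have t0 := @trace_class0 _ H; split.
  have := fl 1 0 0 t0 t0; rewrite scale1r addr0 mul1r.
  by move=> /esym/eqP; rewrite -subr_eq0 addrK => /eqP.
by move=> S T tS tT; rewrite -[S]scale1r fl// mul1r scale1r.
Qed.

(** The functional is nonnegative on finite sums of rank-one projections up to scale. Its bound
    turns the small trace of the remainder into a small error, so [f T] is a limit of nonnegative
    numbers. *)
Lemma trace_functional_ge0 H (f : (H -> H) -> C) T : trace_functional f ->
  (forall v, 0 <= f (ketbra v)) -> positive_trace_class T -> 0 <= f T.
Proof.
move=> ftf fv Tptc; have [f0 fD] := trace_functional_additive ftf.
have [_ [k k0 fk]] := ftf.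
have tk := @trace_class_sum_ketbra R H.
have fsum (s : seq H) : 0 <= f (\sum_(v <- s) ketbra v).
  elim: s => [|v s IH]; first by rewrite big_nil f0.
  rewrite big_cons fD ?addr_ge0//.
  exact/ptc_trace_class/ptc_ketbra.
have approx n : exists p : C, 0 <= p /\ `|f T - p| <= n.+1%:R^-1.
  (* Chosen so that [k] times the trace of the remainder is at most [n.+1%:R^-1], also when
     [k = 0]. *)
  have e0 : 0 < n.+1%:R^-1 / (k + 1) by rewrite divr_gt0 ?invr_gt0 ?ltr_wpDl.
  have [s [Sptc _ Se]] := trace_remainder_small Tptc e0.
  exists (f (\sum_(v <- s) ketbra v)); split; first exact: fsum.
  set S := T - _ in Sptc Se.
  have -> : T = \sum_(v <- s) ketbra v + S by rewrite /S addrC subrK.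
  rewrite fD//; last exact: ptc_trace_class.
  rewrite addrC addKr; apply: le_trans (fk _ Sptc) _.
  apply: (le_trans (ler_wpM2l k0 Se)).
  by rewrite mulrCA ler_piMr ?invr_ge0// ler_pdivrMr ?ltr_wpDl// mul1r lerDl.
have [p /all_and2[p0 fp]] := choice approx.
suff : p @ \oo --> f T by move=> /cvg_ge0; exact.
apply: (@cvg_dominated _ _ _ (fun n => (n.+1%:R^-1 : C)) 0 _ _ 1) => //.
  by move=> n; rewrite mul1r sub0r normrN [leRHS]ger0_norm ?invr_ge0.
exact: cvg_harmonic_complex.
Qed.

(** Both differences vanish on rank-one operators, hence are nonnegative at [T]. *)
Lemma trace_functional_ext H (f g : (H -> H) -> C) T :
  trace_functional f -> trace_functional g ->
  (forall v, f (ketbra v) = g (ketbra v)) -> positive_trace_class T ->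
  f T = g T.
Proof.
move=> ftf gtf fg Tptc; apply/eqP; rewrite eq_le; apply/andP; split.
  rewrite -subr_ge0; apply: (trace_functional_ge0 (f := g - f)) => //.
    exact: trace_functional_sub.
  by move=> v; rewrite !fctE fg subrr.
rewrite -subr_ge0; apply: (trace_functional_ge0 (f := f - g)) => //.
  exact: trace_functional_sub.
by move=> v; rewrite !fctE fg subrr.
Qed.

Lemma trace_comp_ge0 H (T E : H -> H) : positive_op E ->
  positive_trace_class T -> 0 <= trace (T \o E).
Proof.
move=> Epos; apply: (trace_functional_ge0 (trace_functional_comp Epos)).
by move=> v; rewrite trace_ketbra_comp//; have [] := Epos.
Qed.

Lemma psd_trace_functional H (f : (H -> H) -> C) : trace_functional f ->
  (forall v, 0 <= f (ketbra v)) -> psd_form (fun x y => f (dyad x y)).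
Proof.
move=> ftf f0; have td := @trace_class_dyad R H.
split=> [y a u v|x a y z|x]; last exact: f0.
  rewrite (_ : dyad (a *: u + v) y = a *: dyad u y + dyad v y); last first.
    by apply/funext => w; rewrite !fctE /dyad scalerDr !scalerA mulrC.
  by have [fl _] := ftf; rewrite fl.
rewrite (_ : dyad x (a *: y + z) = a^* *: dyad x y + dyad x z); last first.
  apply/funext => w; rewrite !fctE /dyad linearDr/= linearZr_LR/=.
  by rewrite scalerDl scalerA.
by have [fl _] := ftf; rewrite fl.
Qed.

(* Riesz representation: [E x] is the vector whose coordinates are the
   values of [f] on the dyads of [x] with the basis vectors. *)
Lemma trace_functional_riesz H (f : (H -> H) -> C) : trace_functional f ->
  (forall v, 0 <= f (ketbra v)) ->
  exists2 E : H -> H, positive_op E &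
    forall T, positive_trace_class T -> trace (T \o E) = f T.
Proof.
move=> ftf f0; have Bpsd := psd_trace_functional ftf f0.
have [k k0 fk] := ftf.2.
pose B x y := f (dyad x y); have [Bl Br B0] : psd_form B := Bpsd.
have BB x : B x x <= k * `|x| ^+ 2.
  rewrite -[leLHS]ger0_norm ?B0//.
  by apply: le_trans (fk _ (ptc_ketbra x)) _; rewrite trace_ketbra.
have Ble x y : `|B x y| <= k * `|x| * `|y|.
  rewrite -ler_sqr ?nnegrE ?mulr_ge0//.
  apply: le_trans (psd_form_cauchy_schwarz x y Bpsd) _.
  rewrite (_ : _ ^+ 2 = (k * `|x| ^+ 2) * (k * `|y| ^+ 2)); last by ring.
  by apply: ler_pM; [exact: B0|exact: B0|exact: BB|exact: BB].
have Bsum x (c : C^nat) n : B x (\sum_(0 <= i < n) c i *: onb H i) =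
    \sum_(0 <= i < n) (c i)^* * B x (onb H i).
  elim: n => [|n IH]; last by rewrite !big_nat_recr//= addrC Br IH addrC.
  rewrite !big_geq//; have := Br x 1 0 0; rewrite scale1r addr0 conjC1 mul1r.
  by move=> /esym/eqP; rewrite -subr_eq0 addrK => /eqP.
(* Testing the form against the vector [p] built from the coordinates themselves gives [s = B x p];
   as the squared norm of [p] is at most [s], one factor [s] cancels. *)
have coords x n :
    \sum_(0 <= i < n) `|B x (onb H i)| ^+ 2 <= (k * `|x|) ^+ 2.
  set s := \sum_(_ <= _ < _) _; have s0 : 0 <= s.
    by apply: sumr_ge0 => i _; exact: exprn_ge0.
  pose p := \sum_(0 <= i < n) B x (onb H i) *: onb H i.
  have sE : s = B x p.
    by rewrite Bsum; apply: eq_bigr => i _; rewrite normCK mulrC.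
  have sp : s ^+ 2 <= (k * `|x|) ^+ 2 * s.
    rewrite -{1}(ger0_norm s0) {1}sE.
    apply: (@le_trans _ _ ((k * `|x| * `|p|) ^+ 2)).
      by rewrite ler_pXn2r ?nnegrE ?mulr_ge0.
    by rewrite exprMn ler_wpM2l ?exprn_ge0 ?mulr_ge0// norm_onb_sum_le.
  have [->|sn0] := eqVneq s 0; first by rewrite exprn_ge0 ?mulr_ge0.
  by move: sp; rewrite expr2 ler_pM2r// lt_def sn0.
pose E x := limn (series (fun i => B x (onb H i) *: onb H i)).
have Ecvg x : series (fun i => B x (onb H i) *: onb H i) @ \oo --> E x.
  exact: is_cvg_onb_series (coords x).
(* Expanding [E x] on one side and [y] on the other yields the same partial sums, so the two limits
   agree. *)
have EB x y : '[E x, y] = B x y.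
  have h1 := cvg_innerl (y := y) (Ecvg x).
  have h2 : B x (series (fun i => '[y, onb H i] *: onb H i) n) @[n --> \oo]
      --> B x y.
    apply: (@cvg_dominated _ _ _ _ _ _ _ (k * `|x|) _ _ (@onb_expansion _ _ y)).
      by rewrite mulr_ge0.
    move=> n; set z := series _ n.
    suff -> : B x y - B x z = B x (y - z) by exact: Ble.
    by rewrite [y - z]addrC -[- z]scaleN1r Br rmorphN1 mulN1r addrC.
  apply: cvg_unique h1 _; first exact: norm_hausdorff.
  rewrite (_ : (fun n => _) =
    fun n => B x (series (fun i => '[y, onb H i] *: onb H i) n))//.
  apply/funext => n; rewrite /series/= Bsum linear_sumlz/=.
  by apply: eq_bigr => i _; rewrite linearZl_LR/= mulrC innerC.
have Epos : positive_op E.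
  split; last by move=> x; rewrite EB; exact: B0.
  apply: (@norm_le_bounded_op _ _ _ k) => // [a x y|x].
    apply: inner_eq => z; rewrite EB linearDl/= linearZl_LR/= !EB.
    exact: Bl.
  have [->|Ex0] := eqVneq (E x) 0; first by rewrite normr0 mulr_ge0.
  (* The bound on [E x] follows from that on [B x (E x)], which is the squared norm of [E x]. *)
  rewrite -(ler_pM2r (x := `|E x|)) ?normr_gt0//.
  rewrite -expr2 normr_inner EB; apply: le_trans (Ble _ _).
  by rewrite ger0_norm// -EB dnorm_ge0.
exists E => // T Tptc.
apply: (trace_functional_ext (trace_functional_comp Epos) ftf _ Tptc) => v.
by rewrite trace_ketbra_comp// EB.
Qed.

End trace_functionals.

(** * Heisenberg duals of channels, and measure-and-prepare channels *)

Section channels.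
Context {R : realType}.
Implicit Types H K L : sepHilbertType R.
Local Notation C := R[i].

Lemma cptp_comp H K L (Omega : (H -> H) -> (K -> K))
    (Lambda : (K -> K) -> (L -> L)) :
  cptp Omega -> cptp Lambda -> cptp (Lambda \o Omega).
Proof.
move=> [Oc Ol Op Ot] [Lc Ll Lp Lt]; split.
- by move=> T tT; apply: Lc; exact: Oc.
- move=> a S T tS tT /=; rewrite Ol// Ll//; exact: Oc.
- move=> n S tS S0; apply: Lp; first by move=> i j; exact: Oc.
  exact: Op.
- by move=> T tT /=; rewrite Lt ?Ot//; exact: Oc.
Qed.

(** Complete positivity is used with one-by-one blocks. *)
Lemma cptp_ptc H K (Omega : (H -> H) -> (K -> K)) T :
  cptp Omega -> positive_trace_class T -> positive_trace_class (Omega T).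
Proof.
move=> [Oc _ Op _] Tptc; have tT := ptc_trace_class Tptc.
apply: positive_trace_class_psd; first exact: Oc.
move=> x; have [[_ T0] _] := Tptc.
have := Op 1%N (fun _ _ => T) (fun _ _ => tT).
have T1 : block_positive (fun _ _ : 'I_1 => T).
  by move=> y; rewrite !big_ord1; exact: T0.
by move=> /(_ T1 (fun=> x)); rewrite !big_ord1.
Qed.

Lemma cptp_density H K (Omega : (H -> H) -> (K -> K)) T :
  cptp Omega -> density_op T -> density_op (Omega T).
Proof.
move=> Ocptp [Tptc T1]; split; first exact: cptp_ptc.
by have [_ _ _ ->] := Ocptp; last exact: ptc_trace_class.
Qed.

(** Preservation of positivity and of the trace carries the bound over with the same constant. *)
Lemma trace_functional_cptp H K (Omega : (H -> H) -> (K -> K)) f :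
  cptp Omega -> trace_functional f -> trace_functional (f \o Omega).
Proof.
move=> Ocptp [fl [k k0 fk]]; have [Oc Ol _ Ot] := Ocptp; split.
  by move=> a S T tS tT /=; rewrite Ol// fl//; exact: Oc.
exists k => // P Pptc /=; rewrite -(Ot _ (ptc_trace_class Pptc)).
by apply: fk; exact: cptp_ptc.
Qed.

(** The representation theorem applies because [Omega] preserves positivity and [trace (T \o E)] is
    nonnegative for positive trace-class [T]. *)
Lemma cptp_dual H K (Omega : (H -> H) -> (K -> K)) (E : K -> K) :
  cptp Omega -> positive_op E ->
  exists2 E' : H -> H, positive_op E' &
    forall T, positive_trace_class T -> trace (T \o E') = trace (Omega T \o E).
Proof.
move=> Ocptp Epos.
have ftf := trace_functional_cptp Ocptp (trace_functional_comp Epos).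
apply: (trace_functional_riesz ftf) => v /=.
by apply: trace_comp_ge0 => //; apply: cptp_ptc => //; exact: ptc_ketbra.
Qed.

(** The difference has zero quadratic form, so it is itself positive, and Cauchy-Schwarz makes it
    vanish. *)
Lemma positive_op_diag_eq H (S T : H -> H) : positive_op S -> positive_op T ->
  (forall x, '[S x, x] = '[T x, x]) -> S = T.
Proof.
move=> [bS _] [bT _] ST.
pose D := (-1) *: S + T.
have DE x : D x = T x - S x by rewrite /D !fctE scaleN1r addrC.
have D0 x : '[D x, x] = 0 by rewrite DE linearBl/= ST subrr.
have Dpos : positive_op D.
  by split=> [|x]; [exact: bounded_op_lin|rewrite D0].
apply/esym/funext => x; apply/eqP; rewrite -subr_eq0 -DE; apply/eqP.
apply: inner_eq => y; rewrite inner0l; apply/eqP.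
rewrite -normr_eq0 -sqrf_eq0 eq_le exprn_ge0// andbT.
by have := psd_form_cauchy_schwarz x y (positive_psd Dpos); rewrite D0 mul0r.
Qed.

Lemma positive_formZ H (E : H -> H) a x : positive_op E -> 0 <= a ->
  '[E (a *: x), a *: x] = a ^+ 2 * '[E x, x].
Proof.
move=> [[/linear_linear[f <-] _] _] a0.
have -> : f (a *: x) = a *: f x by exact: linearZ.
rewrite linearZl_LR/= linearZr_LR/= conj_Creal ?ger0_real//.
by rewrite expr2 -mulrA.
Qed.

Lemma density_ketbra H (u : H) : `|u| = 1 -> density_op (ketbra u).
Proof.
by move=> u1; split; [exact: ptc_ketbra|rewrite trace_ketbra u1 expr1n].
Qed.

(** The traces are finite real values of the measure [mu], whose countable additivity thus passes to
    a complex series. *)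
Lemma cvg_outcome_law d (X : measurableType d) H (E : set X -> (H -> H)) sigma
    (mu : {measure set X -> \bar R}) (F : (set X)^nat) :
  is_outcome_law E sigma mu ->
  (forall A, measurable A -> 0 <= trace (sigma \o E A)) ->
  (forall i, measurable (F i)) -> trivIset setT F ->
  series (fun i => trace (sigma \o E (F i))) @ \oo
    --> trace (sigma \o E (\bigcup_i F i)).
Proof.
move=> muE E0 mF tF.
have mbF : measurable (\bigcup_i F i) by exact: bigcup_measurable.
have realE A : measurable A ->
    trace (sigma \o E A) = (complex.Re (trace (sigma \o E A)))%:C%C.
  by move=> mA; rewrite RRe_real// ger0_real// E0.
have muF : (\sum_(0 <= i < n) mu (F i))%E @[n --> \oo] --> mu (\bigcup_i F i).
  exact: measure_semi_sigma_additive.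
move: muF; rewrite (muE _ mbF) => /fine_cvgP[_ /cvg_real_complex]; rewrite -realE//.
rewrite (_ : (fun n => _) = series (fun i => trace (sigma \o E (F i))))//.
apply/funext => n; rewrite /series/= /comp.
under eq_bigr do rewrite muE//.
by rewrite sumEFin/= rmorph_sum; apply: eq_bigr => i _; exact/esym/realE.
Qed.

(** The dual effects are chosen set by set; normalisation then follows from trace preservation and
    countable additivity from the outcome laws. *)
Lemma povm_dual d (X : measurableType d) H K (Omega : (H -> H) -> (K -> K))
    (E : set X -> (K -> K)) :
  cptp Omega -> povm E ->
  (forall sigma, density_op sigma ->
    exists mu : {measure set X -> \bar R}, is_outcome_law E sigma mu) ->
  exists2 E' : set X -> (H -> H), povm E' &
    forall sigma mu, density_op sigma -> is_outcome_law E (Omega sigma) mu ->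
      is_outcome_law E' sigma mu.
Proof.
move=> Ocptp [Epos ET _] Elaw; have [_ _ _ Otr] := Ocptp.
have dual A : exists E' : H -> H, measurable A -> positive_op E' /\
    forall T, positive_trace_class T ->
      trace (T \o E') = trace (Omega T \o E A).
  (* Off the measurable sets [id] is a mere placeholder. *)
  have [mA|nmA] := pselect (measurable A); last by exists id.
  by have [E' ? ?] := cptp_dual Ocptp (Epos A mA); exists E'.
have [E' E'P] := choice dual.
have E'pos A : measurable A -> positive_op (E' A) by move=> /E'P[].
have E'tr A T : measurable A -> positive_trace_class T ->
    trace (T \o E' A) = trace (Omega T \o E A).
  by move=> /E'P[_]; exact.
have E'law sigma (mu : {measure set X -> \bar R}) : density_op sigma ->
    is_outcome_law E (Omega sigma) mu -> is_outcome_law E' sigma mu.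
  by move=> [sptc _] muE A mA; rewrite E'tr//; exact: muE.
exists E' => //; split=> //.
- apply: positive_op_diag_eq; first exact: E'pos.
    split; last by move=> x; exact: dnorm_ge0.
    apply: (@norm_le_bounded_op _ _ _ 1) => // x.
    by rewrite mul1r.
  move=> x; rewrite -trace_ketbra_comp; last exact: E'pos.
  rewrite E'tr//; last exact: ptc_ketbra.
  rewrite ET -[_ \o id]/(Omega (ketbra x)) Otr ?trace_ketbra ?normr_inner//.
  exact/ptc_trace_class/ptc_ketbra.
- move=> F mF tF x.
  have mbF : measurable (\bigcup_i F i) by exact: bigcup_measurable.
  (* Outcome laws concern density operators, so a nonzero [x] is normalised first; homogeneity of
     the form restores the squared norm of [x]. *)
  have [->|x0] := eqVneq x 0.
    rewrite inner0r (_ : series _ = fun=> 0); first exact: cvg_cst.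
    by apply/funext => n; rewrite /series/= big1// => i _; rewrite inner0r.
  pose u := `|x|^-1 *: x.
  have du : density_op (ketbra u).
    by apply: density_ketbra; rewrite normrZ normfV normr_id mulVf ?normr_eq0.
  have [mu muE] := Elaw _ (cptp_density Ocptp du).
  have := cvg_outcome_law (E'law _ _ du muE) _ mF tF.
  have uE A : measurable A ->
      '[E' A x, x] = `|x| ^+ 2 * trace (ketbra u \o E' A).
    move=> mA; rewrite trace_ketbra_comp; last exact: E'pos.
    rewrite -positive_formZ//; last exact: E'pos.
    by rewrite scalerA divff ?normr_eq0// scale1r.
  rewrite uE//.
  rewrite (_ : series (fun i => '[E' (F i) x, x]) =
    fun n => `|x| ^+ 2 * series (fun i => trace (ketbra u \o E' (F i))) n).
    move=> h; apply: cvgMr; apply: h => A mA.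
    by apply: trace_comp_ge0; [exact: E'pos|exact: ptc_ketbra].
  apply/funext => n; rewrite /series/= mulr_sumr; apply: eq_bigr => i _.
  by rewrite uE.
Qed.

(** Outcome space and prepared states are kept, and only the POVM is replaced by its dual. The
    outcome law is the same measure, so the integral formula carries over. *)
Lemma mp_channel_comp H K L (Omega : (H -> H) -> (K -> K))
    (Lambda : (K -> K) -> (L -> L)) :
  cptp Omega -> mp_channel Lambda -> mp_channel (Lambda \o Omega).
Proof.
move=> Ocptp [Lcptp [d [X [E [tau [Epovm tauD taum EL]]]]]].
split; first exact: cptp_comp.
have Elaw sigma : density_op sigma ->
    exists mu : {measure set X -> \bar R}, is_outcome_law E sigma mu.
  by move=> /EL[mu muE _]; exists mu.
have [E' E'povm E'law] := povm_dual Ocptp Epovm Elaw.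
exists d, X, E', tau; split=> // sigma sD.
have [mu muE muL] := EL _ (cptp_density Ocptp sD).
by exists mu => //; exact: E'law.
Qed.

End channels.

Theorem proposition1 (R : realType) (HA1 HA2 HA HB : sepHilbertType R)
    (t : HA1 -> HA2 -> HA) (M : nat) (rho : 'I_M -> (HA1 -> HA1))
    (Gamma Delta : 'I_M -> HA) (Omega : (HA -> HA) -> (HA -> HA))
    (rho_out : 'I_M -> (HB -> HB)) (Lambda : (HA -> HA) -> (HB -> HB))
    (J : Type) (O : J -> observable HB) :
  hilbert_tensor t ->
  (forall k, density_op (rho k)) ->
  (forall k, purification t (rho k) (Gamma k)) ->
  (forall k, purification t (rho k) (Delta k)) ->
  cptp Omega ->
  (forall k, Omega (ketbra (Gamma k)) = ketbra (Delta k)) ->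
  cptp Lambda ->
  (forall k, Lambda (ketbra (Gamma k)) = rho_out k) ->
  (forall k, Lambda (ketbra (Delta k)) = rho_out k) ->
  unsuccessful O rho_out Delta ->
  unsuccessful O rho_out Gamma.
Proof.
move=> _ _ _ _ Ocptp OGD _ _ _ [Sigma [Smp Scomp]].
exists (Sigma \o Omega); split; first exact: mp_channel_comp.
by move=> k /=; rewrite OGD.
Qed.
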